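(* Let $\mathbb{T}$ be a geometric theory over a signature $\Sigma$ and let $\phi,\psi$ be two geometric sentences over $\Sigma$ such that the sequent $\top\vdash_{[]}\psi$ is provable in the theory $\mathbb{T}\cup\{\top\vdash_{[]}\phi\}$. Then the sequent $\phi\vdash_{[]}\psi$ is provable in the theory $\mathbb{T}$.
   Context: Geometric formulae are built from atomic formulae (including equalities) using $\top$, finite conjunctions, arbitrary (set-indexed) disjunctions and existential quantification; a geometric sentence is a geometric formula in the empty context $[]$. Provability refers to the standard sequent calculus of (infinitary) geometric logic, with sequents $\phi\vdash_{\vec{x}}\psi$ in a finite context $\vec{x}$. *)

(* Defs.v *)
From Stdlib Require Export List Ensembles.
Export ListNotations.

Set Implicit Arguments.
Unset Strict Implicit.

Record signature := Signature {
  sort : Type;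
  fsym : Type;
  fdom : fsym -> list sort;
  fcod : fsym -> sort;
  rsym : Type;
  rdom : rsym -> list sort
}.

(** A context is the list of the sorts of its variables; variables are typed
    de Bruijn positions, so formulae-in-context are taken up to renaming of
    variables and have finitely many free variables by construction. *)
Definition context (Sg : signature) := list (sort Sg).

Inductive var (S : Type) : list S -> S -> Type :=
| vz (G : list S) (s : S) : var (s :: G) s
| vs (G : list S) (a s : S) : var G s -> var (a :: G) s.

Arguments vz {S G s}.
Arguments vs {S G a s} _.

(** The arguments of a symbol with arity [s1; ...; sn] are given as a function
    on the positions [var [s1; ...; sn] _], i.e. as an n-tuple of terms of the
    prescribed sorts. *)
Inductive term (Sg : signature) (G : context Sg) : sort Sg -> Type :=
| tvar (s : sort Sg) : var G s -> term G s
| tapp (f : fsym Sg) :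
    (forall s, var (fdom f) s -> term G s) -> term G (fcod f).

Arguments tvar {Sg G s} _.

Inductive gform (Sg : signature) : context Sg -> Type :=
| Rel (G : context Sg) (r : rsym Sg) :
    (forall s, var (rdom r) s -> term G s) -> gform G
| Eq (G : context Sg) (s : sort Sg) : term G s -> term G s -> gform G
| Top (G : context Sg) : gform G
| And (G : context Sg) : gform G -> gform G -> gform G
| Disj (G : context Sg) (I : Type) : (I -> gform G) -> gform G
| Ex (G : context Sg) (s : sort Sg) : gform (s :: G) -> gform G.

Arguments Top {Sg G}.

Definition gsentence (Sg : signature) := gform (nil : context Sg).

Definition subst (Sg : signature) (G D : context Sg) :=
  forall s, var G s -> term D s.

Fixpoint term_subst (Sg : signature) (G D : context Sg) (sigma : subst G D)
    (s : sort Sg) (t : term G s) : term D s :=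
  match t with
  | tvar v => sigma _ v
  | tapp args => tapp (fun s v => term_subst sigma (args s v))
  end.

Definition shift (Sg : signature) (G : context Sg) (a : sort Sg) :
  subst G (a :: G) := fun s v => tvar (vs v).

Arguments shift {Sg G} a s _.

Definition up (Sg : signature) (G D : context Sg) (a : sort Sg)
    (sigma : subst G D) : subst (a :: G) (a :: D) :=
  fun s v =>
    match v in var (b :: G') s'
      return subst G' D -> term (b :: D) s' with
    | vz => fun _ => tvar vz
    | vs w => fun sg => term_subst (shift _) (sg _ w)
    end sigma.

Arguments up {Sg G D} a sigma s _.

Fixpoint form_subst (Sg : signature) (G : context Sg) (phi : gform G) :
    forall D : context Sg, subst G D -> gform D :=
  match phi with
  | Rel args => fun D sigma => Rel (fun s v => term_subst sigma (args s v))
  | Eq t u => fun D sigma => Eq (term_subst sigma t) (term_subst sigma u)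
  | Top => fun D sigma => Top
  | And p q => fun D sigma => And (form_subst p sigma) (form_subst q sigma)
  | Disj F => fun D sigma => Disj (fun i => form_subst (F i) sigma)
  | Ex p => fun D sigma => Ex (form_subst p (up _ sigma))
  end.

Definition weaken (Sg : signature) (G : context Sg) (a : sort Sg)
  (phi : gform G) : gform (a :: G) := form_subst phi (shift a).

Arguments weaken {Sg G} a phi.

Record sequent (Sg : signature) := Sequent {
  sctx : context Sg;
  antecedent : gform sctx;
  succedent : gform sctx
}.

Notation "p '|-[' G ']' q" := (@Sequent _ G p q)
  (at level 70, no associativity).

Definition theory (Sg : signature) := Ensemble (sequent Sg).

Definition renaming (Sg : signature) (G : context Sg) :=
  forall s, var G s -> var G s.

Definition ren_subst (Sg : signature) (G : context Sg) (rho : renaming G) :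
  subst G G := fun s v => tvar (rho s v).

(** The conjunction of the equations [x = rho x], for [x] in [xs]. *)
Definition ren_eqs (Sg : signature) (G : context Sg)
    (xs : list {s : sort Sg & var G s}) (rho : renaming G) : gform G :=
  fold_right
    (fun x p => And (Eq (tvar (projT2 x)) (tvar (rho _ (projT2 x)))) p)
    Top xs.

Inductive provable (Sg : signature) (T : theory Sg) : sequent Sg -> Prop :=
| p_axiom (c : sequent Sg) : In _ T c -> provable T c
| p_id (G : context Sg) (p : gform G) : provable T (p |-[G] p)
| p_subst (G D : context Sg) (sigma : subst G D) (p q : gform G) :
    provable T (p |-[G] q) ->
    provable T (form_subst p sigma |-[D] form_subst q sigma)
| p_cut (G : context Sg) (p q r : gform G) :
    provable T (p |-[G] q) -> provable T (q |-[G] r) ->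
    provable T (p |-[G] r)
| p_eq_refl (s : sort Sg) :
    provable T (Top |-[[s]] Eq (tvar vz) (tvar vz))
(** With [ys] the image of [xs] under [rho], and [rho] fixing every other
    variable, this is [(xs = ys) /\ p |- p[ys/xs]] (simultaneous
    substitution of variables for variables). *)
| p_eq_subst (G : context Sg) (xs : list {s : sort Sg & var G s})
    (rho : renaming G) (p : gform G) :
    (forall s (v : var G s), ~ List.In (existT _ s v) xs -> rho s v = v) ->
    provable T (And (ren_eqs xs rho) p |-[G] form_subst p (ren_subst rho))
| p_top (G : context Sg) (p : gform G) : provable T (p |-[G] Top)
| p_and_l (G : context Sg) (p q : gform G) : provable T (And p q |-[G] p)
| p_and_r (G : context Sg) (p q : gform G) : provable T (And p q |-[G] q)
| p_and_i (G : context Sg) (p q r : gform G) :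
    provable T (p |-[G] q) -> provable T (p |-[G] r) ->
    provable T (p |-[G] And q r)
| p_disj_i (G : context Sg) (I : Type) (F : I -> gform G) (i : I) :
    provable T (F i |-[G] Disj F)
| p_disj_e (G : context Sg) (I : Type) (F : I -> gform G) (p : gform G) :
    (forall i, provable T (F i |-[G] p)) -> provable T (Disj F |-[G] p)
| p_ex_l (G : context Sg) (a : sort Sg) (p : gform (a :: G)) (q : gform G) :
    provable T (p |-[a :: G] weaken a q) -> provable T (Ex p |-[G] q)
| p_ex_inv (G : context Sg) (a : sort Sg) (p : gform (a :: G)) (q : gform G) :
    provable T (Ex p |-[G] q) -> provable T (p |-[a :: G] weaken a q)
| p_distr (G : context Sg) (I : Type) (p : gform G) (F : I -> gform G) :
    provable T (And p (Disj F) |-[G] Disj (fun i => And p (F i)))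
| p_frobenius (G : context Sg) (a : sort Sg) (p : gform G)
    (q : gform (a :: G)) :
    provable T (And p (Ex q) |-[G] Ex (And (weaken a p) q)).

(* Main.v *)
(** Induction on derivations in [T + (Top |- phi)] shows that for every
    derivable [p |- q] in context [G], the sequent [phi /\ p |- q] is derivable
    from [T], where [phi] is weakened to [G].  The weakening of a sentence is
    stable under substitution; distributivity handles disjunctions and the
    Frobenius axiom handles existential quantifiers. *)
From Stdlib Require Import FunctionalExtensionality.
Require Import Defs.

Set Implicit Arguments.
Unset Strict Implicit.

Lemma term_subst_tvar (Sg : signature) (G : context Sg) (s : sort Sg)
    (t : term G s) : term_subst (fun s v => tvar v) t = t.
Proof.
  induction t as [s v | f args IH]; simpl; [reflexivity|].
  f_equal. extensionality s. extensionality v. apply IH.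
Qed.

Lemma term_subst_comp (Sg : signature) (G D E : context Sg) (sigma : subst G D)
    (tau : subst D E) (s : sort Sg) (t : term G s) :
  term_subst tau (term_subst sigma t)
  = term_subst (fun s v => term_subst tau (sigma s v)) t.
Proof.
  induction t as [s v | f args IH]; simpl; [reflexivity|].
  f_equal. extensionality s. extensionality v. apply IH.
Qed.

(** The match generalises over the list index and takes [P] as an argument of its branches, so case
    analysis on a variable of [a :: G] needs no uniqueness of identity proofs for sorts. *)
Lemma var_cons_inv (S : Type) (G : list S) (a : S)
    (P : forall s, var (a :: G) s -> Prop) :
  P a vz -> (forall s (w : var G s), P s (vs w)) -> forall s v, P s v.
Proof.
  intros Hz Hs s v.
  refine (match v as v' in var l s'
    return match l return var l s' -> Prop with
           | nil => fun _ => True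
           | b :: G' => fun v' => forall P : forall s, var (b :: G') s -> Prop,
               P b vz -> (forall s (w : var G' s), P s (vs w)) -> P s' v'
           end v' with
    | vz => fun P Hz Hs => Hz
    | vs w => fun P Hz Hs => Hs _ w
    end P Hz Hs).
Qed.

Lemma up_tvar (Sg : signature) (G : context Sg) (a : sort Sg) :
  up a (fun s (v : var G s) => tvar v) = (fun s v => tvar v).
Proof.
  extensionality s. extensionality v. revert s v.
  apply var_cons_inv; reflexivity.
Qed.

Lemma up_comp (Sg : signature) (G D E : context Sg) (a : sort Sg)
    (sigma : subst G D) (tau : subst D E) :
  (fun s v => term_subst (up a tau) (up a sigma s v))
  = up a (fun s v => term_subst tau (sigma s v)).
Proof.
  extensionality s. extensionality v. revert s v.
  apply var_cons_inv; [reflexivity|]. intros s w; simpl.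
  now rewrite !term_subst_comp.
Qed.

Lemma form_subst_tvar (Sg : signature) (G : context Sg) (p : gform G) :
  form_subst p (fun s v => tvar v) = p.
Proof.
  induction p as [G r args | G s t u | G | G p IHp q IHq | G I F IH | G a p IH];
    simpl.
  - f_equal. extensionality s. extensionality v. apply term_subst_tvar.
  - now rewrite !term_subst_tvar.
  - reflexivity.
  - now rewrite IHp, IHq.
  - f_equal. extensionality i. apply IH.
  - now rewrite up_tvar, IH.
Qed.

Lemma form_subst_comp (Sg : signature) (G : context Sg) (p : gform G) :
  forall (D E : context Sg) (sigma : subst G D) (tau : subst D E),
  form_subst (form_subst p sigma) tau
  = form_subst p (fun s v => term_subst tau (sigma s v)).
Proof.
  induction p as [G r args | G s t u | G | G p IHp q IHq | G I F IH | G a p IH];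
    intros D E sigma tau; simpl.
  - f_equal. extensionality s. extensionality v. apply term_subst_comp.
  - now rewrite !term_subst_comp.
  - reflexivity.
  - now rewrite IHp, IHq.
  - f_equal. extensionality i. apply IH.
  - now rewrite IH, up_comp.
Qed.

(** Both constructors produce a non-empty context, where the return type is [unit]. Landing in
    [Type] lets this define terms as well as refute. *)
Definition var_nil_elim (S : Type) (A : S -> Type) (s : S)
    (v : var (@nil S) s) : A s :=
  match v in var l s' return match l with nil => A s' | _ :: _ => unit end with
  | vz => tt
  | vs _ => tt
  end.

Definition empty_subst (Sg : signature) (G : context Sg) :
  subst (nil : context Sg) G := fun s v => var_nil_elim (term G) v.

Lemma empty_subst_unique (Sg : signature) (G : context Sg)
    (sigma : subst (nil : context Sg) G) : sigma = empty_subst G.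
Proof.
  extensionality s. extensionality v.
  destruct (var_nil_elim (fun _ => False) v).
Qed.

Definition lift_sentence (Sg : signature) (G : context Sg)
    (phi : gsentence Sg) : gform G := form_subst phi (empty_subst G).

(** Composing with [sigma] gives another substitution out of the empty context, and there is only
    one. *)
Lemma lift_sentence_subst (Sg : signature) (G D : context Sg)
    (sigma : subst G D) (phi : gsentence Sg) :
  form_subst (lift_sentence G phi) sigma = lift_sentence D phi.
Proof.
  unfold lift_sentence. rewrite form_subst_comp. f_equal.
  apply empty_subst_unique.
Qed.

Lemma lift_sentence_nil (Sg : signature) (phi : gsentence Sg) :
  lift_sentence nil phi = phi.
Proof.
  unfold lift_sentence.
  (* On the empty context the empty substitution is the identity. *)
  rewrite <- (empty_subst_unique (fun s v => tvar v)).
  apply form_subst_tvar.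
Qed.

Section Derived.

Context (Sg : signature) (T : theory Sg).

Lemma provable_ex_weaken (G : context Sg) (a : sort Sg) (p : gform (a :: G)) :
  provable T (p |-[a :: G] weaken a (Ex p)).
Proof. apply p_ex_inv, p_id. Qed.

Lemma provable_and_r (G : context Sg) (l p q : gform G) :
  provable T (p |-[G] q) -> provable T (And l p |-[G] q).
Proof. apply p_cut, p_and_r. Qed.

(** The converse of Frobenius, needed where an existential on the left is eliminated by
    [p_ex_inv]. *)
Lemma provable_ex_and_weaken (G : context Sg) (a : sort Sg) (l : gform G)
    (p : gform (a :: G)) :
  provable T (Ex (And (weaken a l) p) |-[G] And l (Ex p)).
Proof.
  apply p_and_i; apply p_ex_l.
  - apply p_and_l.
  - apply provable_and_r, provable_ex_weaken.
Qed.

(** The sequent is arbitrary because a derivation between sentences may pass through non-empty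
    contexts. *)
Theorem deduction (phi : gsentence Sg) (c : sequent Sg) :
  provable (Add _ T (Top |-[[]] phi)) c ->
  provable T (And (lift_sentence (sctx c) phi) (antecedent c)
              |-[sctx c] succedent c).
Proof.
  induction 1 as
    [c Hc | | G D sigma p q _ IH | G p q r _ IHpq _ IHqr | s | G xs rho p Hrho
    | | G p q | G p q | G p q r _ IHq _ IHr | G I F i | G I F p _ IH
    | G a p q _ IH | G a p q _ IH | G I p F | G a p q];
    cbn [sctx antecedent succedent] in *.
  - destruct Hc as [c Hc | c Hc].
    + apply provable_and_r, p_axiom. now destruct c.
    (* The added axiom: its antecedent now contains [phi] itself, so a projection suffices. *)
    + destruct Hc; cbn [sctx antecedent succedent].
      rewrite lift_sentence_nil. apply p_and_l.
  - apply p_and_r.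
  - apply (p_subst sigma) in IH. simpl in IH.
    now rewrite lift_sentence_subst in IH.
  (* Both premises use [phi], so it is kept alongside the cut formula [q]. *)
  - eapply p_cut; [|exact IHqr]. apply p_and_i; [apply p_and_l | exact IHpq].
  - apply provable_and_r, p_eq_refl.
  - apply provable_and_r, p_eq_subst, Hrho.
  - apply p_top.
  - apply provable_and_r, p_and_l.
  - apply provable_and_r, p_and_r.
  - now apply p_and_i.
  - apply provable_and_r, p_disj_i.
  - eapply p_cut; [apply p_distr|]. now apply p_disj_e.
  (* Frobenius brings [phi] under the quantifier in weakened form, which is its lift to [a :: G]. *)
  - eapply p_cut; [apply p_frobenius|]. apply p_ex_l.
    unfold weaken at 1. now rewrite lift_sentence_subst.
  (* Reading the lift to [a :: G] as a weakening from [G] gives the goal the shape of a conclusion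
     of [p_ex_inv]. *)
  - rewrite <- (lift_sentence_subst (shift a) phi).
    apply p_ex_inv. eapply p_cut; [apply provable_ex_and_weaken | exact IH].
  - apply provable_and_r, p_distr.
  - apply provable_and_r, p_frobenius.
Qed.

End Derived.

Theorem theorem13p1 (Sg : signature) (T : theory Sg) (phi psi : gsentence Sg)
  (H : provable (Add _ T (Top |-[[]] phi)) (Top |-[[]] psi)) :
  provable T (phi |-[[]] psi).
Proof.
  apply deduction in H. simpl in H. rewrite lift_sentence_nil in H.
  (* The antecedent obtained is [And phi Top], which [phi] entails. *)
  eapply p_cut; [|exact H]. apply p_and_i; [apply p_id | apply p_top].
Qed.
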